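(* The following problem is undecidable: given finite disjoint sets $AP_{in}$, $AP_{out}$ of atomic propositions and a HyperLTL formula $\varphi$ over $AP=AP_{in}\,\dot\cup\,AP_{out}$, decide whether there exists an LTL formula $\psi$ over $AP$ such that for all strategies $\sigma:(2^{AP_{in}})^+\to 2^{AP_{out}}$, $\mathit{traces}(\sigma)\models\varphi$ holds if and only if every $t\in\mathit{traces}(\sigma)$ satisfies $t\models\psi$.
   Context: HyperLTL over $AP$: formulas $\varphi::=\forall\pi.\varphi\mid\exists\pi.\varphi\mid\psi$, $\psi::=a_\pi\mid\neg\psi\mid\psi\wedge\psi\mid X\psi\mid\psi U\psi$ ($a\in AP$, $\pi$ a trace variable), evaluated on a set $T\subseteq(2^{AP})^\omega$ with an assignment $\Pi$ of trace variables to $T$ and a time $i$: $a_\pi$ holds iff $a\in\Pi(\pi)(i)$; $X$, $U$, Boolean connectives as in LTL; quantifiers range over $T$; $T\models\varphi$ iff $\varphi$ holds at time 0 under the empty assignment. LTL formulas are quantifier-free HyperLTL bodies over a single trace. For a strategy $\sigma:(2^{AP_{in}})^+\to 2^{AP_{out}}$ and $w=w_0w_1\cdots\in(2^{AP_{in}})^\omega$, $\sigma_w=(w_0\cup\sigma(w_0))(w_1\cup\sigma(w_0w_1))\cdots$, and $\mathit{traces}(\sigma)=\{\sigma_w:w\in(2^{AP_{in}})^\omega\}$. *)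

(* Defs.v *)
From mathcomp Require Import all_boot.
From mathcomp Require Import zify.

Set Implicit Arguments.
Unset Strict Implicit.
Unset Printing Implicit Defensive.

(** * Traces, LTL and HyperLTL *)

Definition trace (A : finType) : Type := nat -> {set A}.

(* The quantifier-free layer; [V] is the type of trace variables. *)
Inductive body (A : finType) (V : Type) : Type :=
| Atom of A & V
| Not of body A V
| And of body A V & body A V
| Next of body A V
| Until of body A V & body A V.

Inductive hyperltl (A : finType) : Type :=
| Forall of nat & hyperltl A
| Exists of nat & hyperltl A
| Body of body A nat.

Arguments Atom {A V}.
Arguments Not {A V}.
Arguments And {A V}.
Arguments Next {A V}.
Arguments Until {A V}.
Arguments Forall {A}.
Arguments Exists {A}.
Arguments Body {A}.

Definition ltl (A : finType) : Type := body A unit.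

(* Assignments are partial, so that there is an empty one. An atom at an
   unassigned variable is false; this never happens for closed formulas. *)
Definition assignment (A : finType) (V : Type) : Type := V -> option (trace A).

Fixpoint body_sat (A : finType) (V : Type) (Pi : assignment A V) (i : nat)
    (psi : body A V) : Prop :=
  match psi with
  | Atom a x => if Pi x is Some t then a \in t i else False
  | Not p => ~ body_sat Pi i p
  | And p q => body_sat Pi i p /\ body_sat Pi i q
  | Next p => body_sat Pi i.+1 p
  | Until p q => exists j, [/\ i <= j, body_sat Pi j q
                             & forall k, i <= k < j -> body_sat Pi k p]
  end.

Definition ltl_sat (A : finType) (t : trace A) (psi : ltl A) : Prop :=
  body_sat (fun _ => Some t) 0 psi.

Definition assign (A : finType) (Pi : assignment A nat) (x : nat) (t : trace A)
  : assignment A nat := fun y => if y == x then Some t else Pi y.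

Definition empty_assignment (A : finType) : assignment A nat := fun _ => None.

Fixpoint hyperltl_sat (A : finType) (T : trace A -> Prop)
    (Pi : assignment A nat) (i : nat) (phi : hyperltl A) : Prop :=
  match phi with
  | Forall x p => forall t, T t -> hyperltl_sat T (assign Pi x t) i p
  | Exists x p => exists t, T t /\ hyperltl_sat T (assign Pi x t) i p
  | Body p => body_sat Pi i p
  end.

Definition models (A : finType) (T : trace A -> Prop) (phi : hyperltl A) : Prop :=
  hyperltl_sat T (@empty_assignment A) 0 phi.

Fixpoint body_closed (A : finType) (bound : seq nat) (psi : body A nat) : bool :=
  match psi with
  | Atom _ x => x \in bound
  | Not p | Next p => body_closed bound p
  | And p q | Until p q => body_closed bound p && body_closed bound q
  end.

Fixpoint closed_under (A : finType) (bound : seq nat) (phi : hyperltl A) : bool :=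
  match phi with
  | Forall x p | Exists x p => closed_under (x :: bound) p
  | Body p => body_closed bound p
  end.

Definition closed (A : finType) (phi : hyperltl A) : bool := closed_under [::] phi.

(** * Strategies *)

Definition nonempty_word (X : eqType) : Type := {u : seq X | u != [::]}.

Definition strategy (Ain Aout : finType) : Type :=
  nonempty_word {set Ain} -> {set Aout}.

(* w_0 ... w_i *)
Definition prefix_upto (X : eqType) (w : nat -> X) (i : nat) : nonempty_word X :=
  exist _ (mkseq w i.+1) isT.

(* The disjoint union of the two alphabets is the sum type. *)
Definition outcome (Ain Aout : finType) (sigma : strategy Ain Aout)
    (w : nat -> {set Ain}) : trace (Ain + Aout)%type :=
  fun i => [set inl a | a in w i] :|: [set inr b | b in sigma (prefix_upto w i)].

Definition traces (Ain Aout : finType) (sigma : strategy Ain Aout)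
  : trace (Ain + Aout)%type -> Prop :=
  fun t => exists w, t = outcome sigma w.

(** * Partial recursive functions and decidability *)

Inductive recf : nat -> Type :=
| RZero n : recf n
| RSucc : recf 1
| RProj n of 'I_n : recf n
| RComp m n of recf m & ('I_m -> recf n) : recf n
| RPrim n of recf n & recf n.+2 : recf n.+1
| RMin n of recf n.+1 : recf n.

(* [eval f x y]: the partial function [f] is defined at [x], with value [y]. *)
Fixpoint eval n (f : recf n) : n.-tuple nat -> nat -> Prop :=
  match f in recf n return n.-tuple nat -> nat -> Prop with
  | RZero _ => fun x y => y = 0
  | RSucc => fun x y => y = (thead x).+1
  | RProj _ i => fun x y => y = tnth x i
  | RComp m _ g h => fun x y =>
      exists z : m.-tuple nat,
        (forall i, eval (h i) x (tnth z i)) /\ eval g z y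
  | RPrim _ g h => fun x =>
      let fix iter k y :=
        if k is k'.+1 then
          exists z, iter k' z /\ eval h [tuple of k' :: z :: behead x] y
        else eval g [tuple of behead x] y
      in iter (thead x)
  | RMin _ g => fun x y =>
      eval g [tuple of y :: x] 0 /\
      forall z, z < y -> exists k, eval g [tuple of z :: x] k.+1
  end.

(* Decidability of a problem whose inputs are presented by their codes. *)
Definition decidable_problem (I : Type) (code : I -> nat) (P : I -> Prop) : Prop :=
  exists d : recf 1, forall x : I,
    (P x -> eval d [tuple code x] 1) /\ (~ P x -> eval d [tuple code x] 0).

Definition undecidable (I : Type) (code : I -> nat) (P : I -> Prop) : Prop :=
  ~ decidable_problem code P.

(** * Instances and their Goedel numbers *)

(* The finite disjoint sets of propositions are, up to renaming,
   {0, ..., n_in - 1} and {0, ..., n_out - 1}. *)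
Record instance : Type := Instance {
  n_in : nat;
  n_out : nat;
  spec : hyperltl ('I_n_in + 'I_n_out)%type;
  spec_closed : closed spec
}.

(* Cantor pairing *)
Definition pair_code (a b : nat) : nat := ((a + b) * (a + b).+1)./2 + b.

Definition atom_code m n (a : ('I_m + 'I_n)%type) : nat :=
  match a with inl i => pair_code 0 i | inr j => pair_code 1 j end.

Fixpoint body_code m n (psi : body ('I_m + 'I_n)%type nat) : nat :=
  match psi with
  | Atom a x => pair_code 0 (pair_code (atom_code a) x)
  | Not p => pair_code 1 (body_code p)
  | And p q => pair_code 2 (pair_code (body_code p) (body_code q))
  | Next p => pair_code 3 (body_code p)
  | Until p q => pair_code 4 (pair_code (body_code p) (body_code q))
  end.

Fixpoint hyperltl_code m n (phi : hyperltl ('I_m + 'I_n)%type) : nat :=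
  match phi with
  | Forall x p => pair_code 0 (pair_code x (hyperltl_code p))
  | Exists x p => pair_code 1 (pair_code x (hyperltl_code p))
  | Body p => pair_code 2 (body_code p)
  end.

Definition instance_code (I : instance) : nat :=
  pair_code (n_in I) (pair_code (n_out I) (hyperltl_code (spec I))).

Lemma pair_code_inj a b c d :
  pair_code a b = pair_code c d -> a = c /\ b = d.
Proof.
have H s : (s * s.+1)./2.*2 = s * s.+1 by rewrite halfK oddM /= andbN subn0.
rewrite /pair_code => E.
have := H (a + b); have := H (c + d); move: E.
set u := _./2; set v := _./2; rewrite -!muln2 => E Hv Hu.
have [lt|lt|e] := ltngtP (a + b) (c + d).
- have : (a + b).+1 * (a + b).+2 <= (c + d) * (c + d).+1 by apply: leq_mul; lia.
  nia.
- have : (c + d).+1 * (c + d).+2 <= (a + b) * (a + b).+1 by apply: leq_mul; lia.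
  nia.
- have : u = v by rewrite /u /v e.
  lia.
Qed.

Lemma atom_code_inj m n : injective (@atom_code m n).
Proof.
by move=> [i|i] [j|j] /pair_code_inj [] // _ /val_inj ->.
Qed.

Lemma body_code_inj m n : injective (@body_code m n).
Proof.
elim=> [a x|p IH|p IHp q IHq|p IH|p IHp q IHq] [b y|p'|p' q'|p'|p' q'] /=
  /pair_code_inj [] // _.
- by move=> /pair_code_inj [/atom_code_inj -> ->].
- by move=> /IH ->.
- by move=> /pair_code_inj [/IHp -> /IHq ->].
- by move=> /IH ->.
- by move=> /pair_code_inj [/IHp -> /IHq ->].
Qed.

Lemma hyperltl_code_inj m n : injective (@hyperltl_code m n).
Proof.
elim=> [x p IH|x p IH|p] [y q|y q|q] /= /pair_code_inj [] // _.
- by move=> /pair_code_inj [-> /IH ->].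
- by move=> /pair_code_inj [-> /IH ->].
- by move=> /body_code_inj ->.
Qed.

Lemma instance_code_inj : injective instance_code.
Proof.
move=> [m n p cp] [m' n' p' cp'] /pair_code_inj /= [em].
move=> /pair_code_inj [en]; subst m' n' => /hyperltl_code_inj ep; subst p'.
by rewrite (bool_irrelevance cp cp').
Qed.

Lemma eval_functional n (f : recf n) x y y' : eval f x y -> eval f x y' -> y = y'.
Proof.
elim: f x y y' => {n} /= [n x y y' -> -> //|x y y' -> -> //|n i x y y' -> -> //
  |m n g IHg h IHh x y y' [z [Hz Hy]] [z' [Hz' Hy']]
  |n g IHg h IHh x|n g IHg x y y' [Hy Hl] [Hy' Hl']].
- suff e : z = z' by apply: IHg Hy _; rewrite e.
  by apply: eq_from_tnth => i; apply: IHh (Hz i) (Hz' i).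
- elim: (thead x) => [|k IHk] y y'; first exact: IHg.
  by move=> [z [Hz Hy]] [z' [/(IHk _ _ Hz) <-]]; apply: IHh.
- case: (ltngtP y y') => // lt.
  + by have [k Hk] := Hl' _ lt; have := IHg _ _ _ Hy Hk.
  + by have [k Hk] := Hl _ lt; have := IHg _ _ _ Hy' Hk.
Qed.

(* Main.v *)
Require Import Defs.
From mathcomp Require Import all_boot.
From mathcomp Require Import boolp zify.

(* A universal HyperLTL sentence can force a strategy to satisfy a finite set of
   Horn clauses over the natural numbers: a trace encodes a tuple of numbers by
   the first positions of its inputs, an output encodes a predicate on tuples,
   and the premises and the conclusion of a clause are compared by quantifying
   over all traces. Every recursive function has such a Horn program, whose least
   model is its graph, so the sentence that adds f(k, m) <> 0 is realizable iff
   f(k, m) = 0 fails. Conjoined with the demand that an unused output have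
   the same initial value on all traces, it is expressible in LTL iff it is
   unrealizable: mixing two realizing strategies according to the first input
   letter violates the demand without creating new traces. A decision procedure d
   is then refuted by diagonalization, f(k, m) being the answer of d on the
   sentence over k inputs whose main part has code m. *)

Set Implicit Arguments.
Unset Strict Implicit.
Unset Printing Implicit Defensive.

(** * Computable functions *)

Definition computable n (F : n.-tuple nat -> nat) : Prop :=
  exists f : recf n, forall x, eval f x (F x).

Lemma computable_proj n (i : 'I_n) : computable (fun x => tnth x i).
Proof. by exists (RProj i). Qed.

Lemma computable_comp m n (G : m.-tuple nat -> nat)
    (H : 'I_m -> n.-tuple nat -> nat) :
  computable G -> (forall i, computable (H i)) ->
  computable (fun x => G [tuple H i x | i < m]).
Proof.
move=> [g Hg] /choice [h Hh]; exists (RComp g h) => x /=.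
by exists [tuple H i x | i < m]; split=> // i; rewrite tnth_mktuple.
Qed.

Lemma computable_succ n (F : n.-tuple nat -> nat) :
  computable F -> computable (fun x => (F x).+1).
Proof.
move=> cF; have := @computable_comp 1 n (fun x => (thead x).+1) (fun _ => F).
rewrite (_ : (fun x => _) = fun x => (F x).+1).
  by apply=> //; exists RSucc.
by apply: funext => x; rewrite /thead tnth_mktuple.
Qed.

Lemma computable_const n c : computable (fun _ : n.-tuple nat => c).
Proof. by elim: c => [|c /computable_succ //]; exists (RZero n). Qed.

(** Arguments are compared through their underlying sequences, so that differently built tuples with
    the same entries can be exchanged. *)
Lemma eval_congr n (f : recf n) x x' y y' :
  eval f x y -> tval x = tval x' -> y = y' -> eval f x' y'.
Proof. by move=> Hf /val_inj <- <-. Qed.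

(** The inner recursion of [eval] on [RPrim], with the parameters split off so that induction can
    run on the recursion argument alone. *)
Fixpoint prim_graph n (g : recf n) (h : recf n.+2) (x : n.-tuple nat) k y : Prop :=
  if k is k'.+1 then
    exists z, prim_graph g h x k' z /\ eval h [tuple of k' :: z :: x] y
  else eval g x y.

Lemma eval_prim n (g : recf n) (h : recf n.+2) x y :
  eval (RPrim g h) x y <-> prim_graph g h [tuple of behead x] (thead x) y.
Proof.
rewrite /=; elim: (thead x) y => [|k IHk] y //=.
by split=> -[z [/IHk Hz Hy]]; exists z; split=> //; apply: eval_congr Hy _ _.
Qed.

Lemma computable_rec n (A G : n.-tuple nat -> nat)
    (H : nat -> nat -> n.-tuple nat -> nat) :
  computable A -> computable G ->
  computable (fun x : n.+2.-tuple nat =>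
    H (thead x) (thead [tuple of behead x]) [tuple of behead (behead x)]) ->
  computable (fun x => nat_rect (fun _ => nat) (G x) (fun k z => H k z x) (A x)).
Proof.
move=> [a Ha] [g Hg] [h Hh].
(* [p] prepends the recursion bound [A x] to the unchanged parameters. *)
pose p (i : 'I_n.+1) := if unlift ord0 i is Some j then RProj j else a.
exists (RComp (RPrim g h) p) => x; exists [tuple of A x :: x]; split.
  by move=> i; rewrite /p; case: unliftP => [j ->|->] /=; rewrite ?tnthS ?tnth0.
apply/eval_prim; rewrite theadE.
have -> : [tuple of behead [tuple of A x :: x]] = x by apply: val_inj.
elim: (A x) => //= k IHk; set z := nat_rect _ _ _ k in IHk *; exists z; split=> //.
apply: eval_congr (Hh [tuple of k :: z :: x]) _ _ => //.
rewrite theadE; congr H; exact: val_inj.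
Qed.

Lemma computable_ext n (F G : n.-tuple nat -> nat) :
  F =1 G -> computable F -> computable G.
Proof. by move=> /funext ->. Qed.

(** Slot 1 holds the accumulator in the step function of [computable_rec]. *)
Lemma computable_second n (F : n.+2.-tuple nat -> nat) :
  (forall x, F x = thead [tuple of behead x]) -> computable F.
Proof.
move=> E; have := computable_proj (Ordinal (isT : 1 < n.+2)).
by apply: computable_ext => x; rewrite E /thead !(tnth_nth 0) /= nth_behead.
Qed.

Lemma computable_comp2 n (op : nat -> nat -> nat) (F G : n.-tuple nat -> nat) :
  computable (fun x : 2.-tuple nat => op (tnth x ord0) (tnth x ord_max)) ->
  computable F -> computable G -> computable (fun x => op (F x) (G x)).
Proof.
move=> cop cF cG.
apply: computable_ext
  (@computable_comp 2 n _ (fun i => if i == ord0 then F else G) cop _) => [x|i].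
  by rewrite !tnth_mktuple.
by case: ifP.
Qed.

Lemma computable_add n (F G : n.-tuple nat -> nat) :
  computable F -> computable G -> computable (fun x => F x + G x).
Proof.
apply: (@computable_comp2 n addn).
have := @computable_rec 2 (fun x => tnth x ord0) (fun x => tnth x ord_max)
  (fun _ z _ => z.+1) (computable_proj _) (computable_proj _)
  (computable_succ (computable_second (fun=> erefl))).
by apply: computable_ext => x; elim: (tnth x ord0) => //= k ->; rewrite addSn.
Qed.

Lemma computable_pair n (F G : n.-tuple nat -> nat) :
  computable F -> computable G -> computable (fun x => pair_code (F x) (G x)).
Proof.
apply: (@computable_comp2 n pair_code).
apply: computable_add; last exact: computable_proj.
(* The triangular number inside the Cantor pairing is accumulated summand by summand, which avoids
   halving. *)
have := @computable_rec 2 (fun x => tnth x ord0 + tnth x ord_max) (fun=> 0)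
  (fun k z _ => k.+1 + z)
  (computable_add (computable_proj _) (computable_proj _)) (computable_const _ _)
  (computable_add (computable_succ (computable_proj _))
     (computable_second (fun=> erefl))).
have half_succ k : (k.+1 * k.+2)./2 = k.+1 + (k * k.+1)./2.
  have -> : k.+1 * k.+2 = k.+1.*2 + k * k.+1 by lia.
  by rewrite halfD odd_double doubleK.
by apply: computable_ext => x; elim: (_ + _) => // k IHk; rewrite half_succ -IHk.
Qed.

(** * Horn clauses over the natural numbers *)

Inductive term := Var of nat | Suc of nat | Zero.

Definition term_eval (v : nat -> nat) (t : term) : nat :=
  match t with Var k => v k | Suc k => (v k).+1 | Zero => 0 end.

(* Predicates see an infinite tuple; a literal constrains its first [arity] entries. *)
Record literal (S : Type) := Literal { psym : S; arity : nat; arg : nat -> term }.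

Record clause (S : Type) :=
  Clause { concl : literal S; n_prem : nat; prem : nat -> literal S }.

Definition interpretation (S : Type) := S -> (nat -> nat) -> Prop.

Definition matches S (v e : nat -> nat) (a : literal S) : Prop :=
  forall j, j < arity a -> e j = term_eval v (arg a j).

Definition clause_holds S (I : interpretation S) (c : clause S) : Prop :=
  forall v e, matches v e (concl c) ->
    (forall i, i < n_prem c -> exists e',
       matches v e' (prem c i) /\ I (psym (prem c i)) e') ->
    I (psym (concl c)) e.

Lemma clause_holds_app S (I : interpretation S) (c : clause S) v p e :
  clause_holds I c -> psym (concl c) = p -> matches v e (concl c) ->
  (forall i, i < n_prem c ->
     I (psym (prem c i)) (fun j => term_eval v (arg (prem c i) j))) ->
  I p e.
Proof.
move=> Hc <- He Hp; apply: (Hc v) => // i /Hp Hi.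
by exists (fun j => term_eval v (arg (prem c i) j)).
Qed.

(** * Recursive functions as Horn programs *)

Fixpoint subsymbol n (f : recf n) : finType :=
  match f with
  | RZero _ | RSucc | RProj _ _ => void : finType
  | RComp m _ g h =>
      (option (subsymbol g) + {i : 'I_m & option (subsymbol (h i))})%type : finType
  | RPrim _ g h => (option (subsymbol g) + option (subsymbol h))%type : finType
  | RMin _ g => option (option (subsymbol g)) : finType
  end.

(* [None] stands for the graph of [f], with the value in slot [n]; the other
   symbols belong to the subterms of [f], except [Some None] for [RMin _ g],
   which says that [g] is positive below slot 0. *)
Definition symbol n (f : recf n) : finType := option (subsymbol f).

Definition args n (e : nat -> nat) : n.-tuple nat := [tuple of mkseq e n].

Definition graph n (f : recf n) (e : nat -> nat) : Prop := eval f (args n e) (e n).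

Fixpoint standard n (f : recf n) : interpretation (symbol f) :=
  match f return interpretation (symbol f) with
  | RZero n => fun _ => graph (RZero n)
  | RSucc => fun _ => graph RSucc
  | RProj n i => fun _ => graph (RProj i)
  | RComp m n g h => fun s =>
      match s with
      | None => graph (RComp g h)
      | Some (inl s') => standard s'
      | Some (inr (existT i s')) => standard s'
      end
  | RPrim n g h => fun s =>
      match s with
      | None => graph (RPrim g h)
      | Some (inl s') => standard s'
      | Some (inr s') => standard s'
      end
  | RMin n g => fun s =>
      match s with
      | None => graph (RMin g)
      | Some None => fun e =>
          forall z, z < e 0 -> exists k, eval g [tuple of z :: args n (e \o succn)] k.+1
      | Some (Some s') => standard s'
      end
  end.

Lemma standard_None n (f : recf n) : standard (None : symbol f) = graph f.
Proof. by case: f. Qed.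

Definition rule0 S (p : S) n (a : nat -> term) : clause S :=
  Clause (Literal p n a) 0 (fun _ => Literal p n a).

(* Each symbol [s] is the conclusion of the two clauses [program emb s b]; they coincide
   when one suffices. [emb] places the symbols of [f] among those of a larger
   program. *)
Fixpoint program n (f : recf n) (S : Type) :
    (symbol f -> S) -> symbol f -> bool -> clause S :=
  match f return (symbol f -> S) -> symbol f -> bool -> clause S with
  | RZero n => fun emb s b =>
      rule0 (emb None) n.+1 (fun j => if j == n then Zero else Var j)
  | RSucc => fun emb s b =>
      rule0 (emb None) 2 (fun j => if j == 1 then Suc 0 else Var j)
  | RProj n i => fun emb s b =>
      rule0 (emb None) n.+1 (fun j => if j == n then Var i else Var j)
  | RComp m n g h => fun emb s b =>
      match s with
      | None =>
          Clause (Literal (emb None) n.+1 Var) m.+1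
            (fun i => if insub i is Some i' then
                Literal (emb (Some (inr (existT _ i' None)))) n.+1
                  (fun j => if j == n then Var (n.+1 + i) else Var j)
              else Literal (emb (Some (inl None))) m.+1
                  (fun j => if j == m then Var n else Var (n.+1 + j)))
      | Some (inl s') => program (fun s => emb (Some (inl s))) s' b
      | Some (inr (existT i s')) =>
          program (fun s => emb (Some (inr (existT _ i s)))) s' b
      end
  | RPrim n g h => fun emb s b =>
      match s with
      | None =>
          if b then
            Clause (Literal (emb None) n.+2
                (fun j => if j is j'.+1 then Var j' else Zero))
              1 (fun _ => Literal (emb (Some (inl None))) n.+1 Var)
          else
            Clause (Literal (emb None) n.+2
                (fun j => if j is j'.+1 then Var j' else Suc n.+1))
              2 (fun i => if i == 0 then
                  Literal (emb None) n.+2 (fun j => if j is j'.+1 then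
                    if j' == n then Var n.+2 else Var j' else Var n.+1)
                else
                  Literal (emb (Some (inr None))) n.+3
                    (fun j => match j with
                              | 0 => Var n.+1
                              | 1 => Var n.+2
                              | j'.+2 => Var j' end))
      | Some (inl s') => program (fun s => emb (Some (inl s))) s' b
      | Some (inr s') => program (fun s => emb (Some (inr s))) s' b
      end
  | RMin n g => fun emb s b =>
      match s with
      | None =>
          Clause (Literal (emb None) n.+1 Var) 2
            (fun i => if i == 0 then
                Literal (emb (Some (Some None))) n.+2
                  (fun j => if j is j'.+1 then
                     if j' == n then Zero else Var j' else Var n)
              else
                Literal (emb (Some None)) n.+1
                  (fun j => if j is j'.+1 then Var j' else Var n))
      | Some None =>
          if b then rule0 (emb (Some None)) n.+1
                     (fun j => if j is j'.+1 then Var j' else Zero)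
          else
            Clause (Literal (emb (Some None)) n.+1
                (fun j => if j is j'.+1 then Var j' else Suc n))
              2 (fun i => if i == 0 then
                  Literal (emb (Some None)) n.+1
                    (fun j => if j is j'.+1 then Var j' else Var n)
                else
                  Literal (emb (Some (Some None))) n.+2
                    (fun j => if j is j'.+1 then
                       if j' == n then Suc n.+1 else Var j' else Var n))
      | Some (Some s') => program (fun s => emb (Some (Some s))) s' b
      end
  end.

Lemma eq_in_mkseq n (e e' : nat -> nat) :
  (forall j, j < n -> e j = e' j) -> mkseq e n = mkseq e' n.
Proof. by move=> E; apply/eq_in_map => j; rewrite mem_iota; apply: E. Qed.

Lemma mkseqS n (e : nat -> nat) : mkseq e n.+1 = e 0 :: mkseq (e \o succn) n.
Proof. by rewrite /mkseq /= (iotaDl 1) -map_comp. Qed.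

Lemma tnth_args n e i : tnth (args n e) i = e i.
Proof. by rewrite (tnth_nth 0) nth_mkseq. Qed.

Lemma mkseq_tnth n (x : n.-tuple nat) (e : nat -> nat) :
  (forall i : 'I_n, e i = tnth x i) -> mkseq e n = x.
Proof.
move=> E; have -> // : x = args n e.
by apply: eq_from_tnth => i; rewrite tnth_args.
Qed.

Lemma behead_args n e : [tuple of behead (args n.+1 e)] = args n (e \o succn).
Proof. by apply: val_inj; apply: (congr1 behead (mkseqS n e)). Qed.

Lemma graph_prim n (g : recf n) (h : recf n.+2) e :
  graph (RPrim g h) e <-> prim_graph g h (args n (e \o succn)) (e 0) (e n.+1).
Proof.
have -> : e 0 = thead (args n.+1 e) by rewrite /thead tnth_args.
by rewrite -behead_args; apply: eval_prim.
Qed.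

(** Structural induction reads each evaluation as a derivation, so every model contains the graph.
    Where a valuation [v] is introduced, it combines entries of [e] with intermediate values of the
    evaluation. *)
Theorem program_sound n (f : recf n) S (emb : symbol f -> S) (I : interpretation S) :
  (forall s b, clause_holds I (program emb s b)) ->
  forall e, graph f e -> I (emb None) e.
Proof.
elim: f S emb I => {n} [n| |n i|m n g IHg h IHh|n g IHg h IHh|n g IHg] S emb I HI e.
- move=> E; apply: (clause_holds_app (v := e) (HI None true) erefl) => // j _ /=.
  by case: eqP => [->|].
- move=> E; apply: (clause_holds_app (v := e) (HI None true) erefl) => // j _ /=.
  by case: eqP => [->|//]; rewrite E /thead tnth_args.
- move=> E; apply: (clause_holds_app (v := e) (HI None true) erefl) => // j _ /=.
  by case: eqP => [->|//]; rewrite E tnth_args.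
- move=> [z [Hz Hy]].
  (* Variables 0 to [n] carry the arguments and the value, variable [n.+1 + i] the value of
     [h i]. *)
  pose v j := if j <= n then e j else nth 0 z (j - n.+1).
  apply: (clause_holds_app (v := v) (HI None true) erefl) => [j|i] /=.
    by rewrite ltnS /v => ->.
  case: insubP => [i' _ <-|] /= Hi.
    apply: (IHh i' _ (fun s => emb (Some (inr (existT _ i' s))))) => [s b|].
      exact: (HI (Some (inr (existT _ i' s)))).
    apply: eval_congr (Hz i') _ _.
      apply: eq_in_mkseq => j Hj.
      by rewrite (ltn_eqF Hj) /= /v ltnW.
    by rewrite eqxx /= /v ifN -?ltnNge ?leq_addr // addKn (tnth_nth 0).
  move=> Him; have {Hi Him i} _ : i = m by lia.
  apply: (IHg _ (fun s => emb (Some (inl s)))) => [s b|].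
    exact: (HI (Some (inl s))).
  apply: eval_congr Hy _ _.
    apply/esym; apply: mkseq_tnth => j.
    by rewrite (ltn_eqF (ltn_ord j)) /= /v ifN -?ltnNge ?leq_addr // addKn (tnth_nth 0).
  by rewrite eqxx /= /v leqnn.
- move=> /graph_prim; move Ek: (e 0) => k.
  elim: k e Ek => [|k IHk] e e0.
    move=> Hg; apply: (clause_holds_app (v := e \o succn) (HI None true) erefl).
      by case.
    move=> i _ /=; apply: (IHg _ (fun s => emb (Some (inl s)))) => [s b|//].
    exact: (HI (Some (inl s))).
  move=> [z [Hz Hy]].
  (* Variables 0 to [n] carry the parameters and the value, [n.+1] the predecessor of the recursion
     argument, [n.+2] the previous value. *)
  pose v j := if j <= n then e j.+1 else if j == n.+1 then k else z.
  have v1 : v n.+1 = k by rewrite /v ltnn eqxx.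
  have v2 : v n.+2 = z by rewrite /v ifN ?ifN; lia.
  have vx : mkseq v n = mkseq (e \o succn) n.
    by apply: eq_in_mkseq => j Hj; rewrite /v ltnW.
  apply: (clause_holds_app (v := v) (HI None false) erefl) => [[|j]|[|[|//]] _] /=.
  + by rewrite v1.
  + by rewrite !ltnS /v => ->.
  + apply: IHk => //=; rewrite eqxx /= v2; move: Hz.
    congr prim_graph; apply: val_inj; rewrite /= -vx.
    by apply: eq_in_mkseq => j Hj /=; rewrite (ltn_eqF Hj).
  + apply: (IHh _ (fun s => emb (Some (inr s)))) => [s b|].
      exact: (HI (Some (inr s))).
    apply: eval_congr Hy _ _; last by rewrite /= /v leqnn.
    by rewrite /= !mkseqS /= v1 v2 -vx.
(* Positivity below [y] is derived by induction on [y]. In the step, variable [n] is the predecessor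
   of the bound and [n.+1] the predecessor of the value of [g] there. *)
- have HB y : forall e, e 0 = y -> (forall z, z < y -> exists k,
      eval g [tuple of z :: args n (e \o succn)] k.+1) -> I (emb (Some None)) e.
    elim: y => [|y IHy] {}e e0 Hpos.
      by apply: (clause_holds_app (v := e \o succn) (HI (Some None) true) erefl) => [[]|].
    have [k Hk] := Hpos y (ltnSn y).
    pose v j := if j < n then e j.+1 else if j == n then y else k.
    have vn : v n = y by rewrite /v ltnn eqxx.
    have vn1 : v n.+1 = k by rewrite /v ifN ?ifN; lia.
    have vx : mkseq v n = mkseq (e \o succn) n.
      by apply: eq_in_mkseq => j Hj; rewrite /v Hj.
    apply: (clause_holds_app (v := v) (HI (Some None) false) erefl)
      => [[|j]|[|[|//]] _] /=.
    + by rewrite vn.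
    + by rewrite ltnS /v => ->.
    + apply: IHy => // z Hz; have [|k' Hk'] := Hpos z; first by lia.
      by exists k'; apply: eval_congr Hk' _ _ => //; rewrite /= -vx.
    + apply: (IHg _ (fun s => emb (Some (Some s)))) => [s b|].
        exact: (HI (Some (Some s))).
      apply: eval_congr Hk _ _; last by rewrite /= eqxx /= vn1.
      rewrite /= mkseqS /= vn -vx; congr (_ :: _).
      by apply: eq_in_mkseq => j Hj /=; rewrite (ltn_eqF Hj).
  move=> [H0 Hpos]; apply: (clause_holds_app (v := e) (HI None true) erefl)
    => [//|[|[|//]] _] /=.
    apply: (IHg _ (fun s => emb (Some (Some s)))) => [s b|].
      exact: (HI (Some (Some s))).
    apply: eval_congr H0 _ _; last by rewrite /= eqxx.
    rewrite /= mkseqS; congr (_ :: _).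
    by apply: eq_in_mkseq => j Hj /=; rewrite (ltn_eqF Hj).
  exact: HB.
Qed.

(** Each clause mirrors one way in which [eval] produces a value, so the intended interpretation is
    a model. The standard strategy below plays exactly this model. *)
Theorem standard_program n (f : recf n) S (emb : symbol f -> S) (I : interpretation S) :
  (forall s, I (emb s) = standard s) ->
  forall s b, clause_holds I (program emb s b).
Proof.
elim: f S emb I => {n} [n| |n i|m n g IHg h IHh|n g IHg h IHh|n g IHg] S emb I HI.
- move=> s b v e He _; rewrite [I _]HI.
  by have := He n (leqnn _); rewrite /= eqxx.
- move=> s b v e He _; rewrite [I _]HI.
  by rewrite /= /graph /= /thead tnth_args (He 0) // (He 1).
- move=> s b v e He _; rewrite [I _]HI.
  rewrite /= /graph /= tnth_args (He n) //= eqxx (He i) 1?ltnW ?ltnS //=.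
  by rewrite (ltn_eqF (ltn_ord i)).
- move=> [[s|[i s]]|] b; first exact: IHg.
    exact: IHh.
  move=> v e He Hp; rewrite [I _]HI.
  exists [tuple v (n.+1 + i) | i < m]; split=> [i|].
    have [|e' /=] := Hp i; first by rewrite ltnW ?ltnS.
    rewrite valK /= HI /= standard_None => -[He' Hh].
    apply: eval_congr Hh _ _.
      apply: eq_in_mkseq => j Hj.
      by rewrite He' 1?ltnW //= (ltn_eqF Hj) He //= ltnW.
    by rewrite He' //= eqxx tnth_mktuple.
  have [//|e' /=] := Hp m.
  rewrite insubN ?ltnn //= HI /= standard_None => -[He' Hg].
  apply: eval_congr Hg _ _.
    apply: mkseq_tnth => j.
    by rewrite tnth_mktuple He' 1?ltnW ?ltnS //= (ltn_eqF (ltn_ord j)).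
  by rewrite He' //= eqxx He.
- move=> [[s|s]|] b; first exact: IHg.
    exact: IHh.
  case: b => v e He Hp; rewrite [I _]HI; apply/graph_prim.
    have [//|e' /=] := Hp 0; rewrite HI /= standard_None => -[He' Hg].
    rewrite (He 0) //=; apply: eval_congr Hg _ _.
      by apply: eq_in_mkseq => j Hj /=; rewrite He' 1?ltnW //= He //= ltnW.
    by rewrite He' //= He.
  have [//|e1 /=] := Hp 0; rewrite HI => -[He1 /graph_prim Hg].
  have [//|e2 /=] := Hp 1; rewrite HI /= standard_None => -[He2 Hh].
  have ex : args n (e1 \o succn) = args n (e \o succn).
    apply: val_inj; apply: eq_in_mkseq => j Hj /=.
    by rewrite He1 1?ltnW //= (ltn_eqF Hj) He //= ltnW.
  rewrite (He 0) //=; exists (e1 n.+1); split.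
    by rewrite -ex; rewrite (He1 0) in Hg.
  apply: eval_congr Hh _ _.
    rewrite /= !mkseqS /= (He2 0) // (He2 1) //= He1 //= eqxx.
    congr [:: _, _ & _]; apply: eq_in_mkseq => j Hj /=.
    by rewrite He2 1?ltnW //= He //= ltnW.
  by rewrite He2 //= He.
- move=> [[s|]|] b; first exact: IHg.
    case: b => v e He Hp; rewrite [I _]HI /=.
      by move=> z; rewrite (He 0).
    have [//|e1 /=] := Hp 0; rewrite HI /= => -[He1 Hpos].
    have [//|e2 /=] := Hp 1; rewrite HI /= standard_None => -[He2 Hg].
    (* The second premise settles the predecessor of the bound, the first everything below it. *)
    move=> z; rewrite (He 0) //= ltnS leq_eqVlt => /orP [/eqP ->|Hz].
      exists (v n.+1); apply: eval_congr Hg _ _; last by rewrite He2 //= eqxx.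
      rewrite /= mkseqS (He2 0) //; congr (_ :: _).
      apply: eq_in_mkseq => j Hj /=.
      by rewrite He2 1?ltnW //= (ltn_eqF Hj) He //= ltnW.
    have [|k Hk] := Hpos z; first by rewrite (He1 0).
    exists k; apply: eval_congr Hk _ _ => //; congr (_ :: _).
    by apply: eq_in_mkseq => j Hj /=; rewrite He1 // He.
  move=> v e He Hp; rewrite [I _]HI.
  have [//|e1 /=] := Hp 0; rewrite HI /= standard_None => -[He1 Hg].
  have [//|e2 /=] := Hp 1; rewrite HI /= => -[He2 Hpos].
  split.
    apply: eval_congr Hg _ _; last by rewrite He1 //= eqxx.
    rewrite /= mkseqS (He1 0) //= He //; congr (_ :: _).
    apply: eq_in_mkseq => j Hj /=.
    by rewrite He1 1?ltnW //= (ltn_eqF Hj) He //= ltnW.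
  move=> z Hz; have [|k Hk] := Hpos z; first by rewrite (He2 0) //; rewrite (He n) in Hz.
  exists k; apply: eval_congr Hk _ _ => //; congr (_ :: _).
  by apply: eq_in_mkseq => j Hj /=; rewrite He2 //= He //= ltnW.
Qed.

(** * Horn programs as HyperLTL formulas *)

(** Inputs and outputs share the positive size [K.+1], so that propositions can be named by plain
    numbers through [inord]. *)
Notation form K := (body ('I_K.+1 + 'I_K.+1)%type nat).

Definition mark {K} (j x : nat) : form K := Atom (inl (inord j)) x.

Definition flag {K} (j x : nat) : form K := Atom (inr (inord j)) x.

Definition Imp {A : finType} {V} (p q : body A V) : body A V := Not (And p (Not q)).

Definition Ev {A : finType} {V} (p : body A V) : body A V := Until (Imp p p) p.

Definition All {K} (T : Type) (s : seq T) (F : T -> form K) : form K :=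
  foldr (fun a q => And (F a) q) (Imp (mark 0 0) (mark 0 0)) s.

(** An output sees only a finite prefix; a position where all inputs are on guarantees that this
    prefix determines every entry of the tuple. *)
Definition full {K} (x : nat) : form K :=
  All (enum 'I_K.+1) (fun o => Atom (inl o) x).

Definition hold {K} (S : finType) (s : S) (x : nat) : form K :=
  Ev (And (full x) (flag (enum_rank s) x)).

(* A trace stands for the tuple whose entry [j] is the first position of input
   [j]; trace variable 1 holds the values of the variables of a clause, trace
   variable 2 its conclusion and [i.+3] its premise [i]. *)
Definition slot_is {K} (j x : nat) (t : term) : form K :=
  match t with
  | Var k => Until (And (Not (mark j x)) (Not (mark k 1))) (And (mark j x) (mark k 1))
  | Suc k => Until (And (Not (mark j x)) (Not (mark k 1)))
               (And (And (mark k 1) (Not (mark j x))) (Next (mark j x)))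
  | Zero => mark j x
  end.

Definition literal_form {K} S (a : literal S) (x : nat) : form K :=
  All (iota 0 (arity a)) (fun j => slot_is j x (arg a j)).

(** Fullness is demanded of traces 1 and 2 so that all their entries exist; for the premise traces
    [hold] includes it. *)
Definition clause_form {K} (S : finType) (c : clause S) : form K :=
  Imp (And (And (Ev (full 1)) (Ev (full 2)))
        (And (literal_form (concl c) 2)
          (All (iota 0 (n_prem c)) (fun i =>
             And (literal_form (prem c i) i.+3) (hold (psym (prem c i)) i.+3)))))
    (hold (psym (concl c)) 2).

Definition program_form {K} n (f : recf n) : form K :=
  All (enum {: symbol f * bool}) (fun sb => clause_form (program id sb.1 sb.2)).

(* Flag [#|symbol f|] belongs to no symbol. Demanding that its initial value be
   the same on all traces is what no trace property can express. *)
Definition core {K} (f : recf 2) : form K :=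
  And (program_form f)
    (And (Not (And (mark 2 0) (hold (None : symbol f) 0)))
       (Imp (flag #|symbol f| 1) (flag #|symbol f| 2))).

Definition input {K} (j a : nat) : form K :=
  iter a (fun p => And (Not (mark j 0)) (Next p)) (mark j 0).

(** The arguments [K.+1] and [m] enter only as hypotheses on trace 0. Hence [q] need not mention
    [m], and [m] can later be the code of [q] itself. *)
Definition matrix {K} (m : nat) (q : form K) : form K :=
  Imp (And (input 0 K.+1) (input 1 m)) q.

Fixpoint prenex (A : finType) n (p : body A nat) : hyperltl A :=
  if n is n'.+1 then Forall n' (prenex n' p) else Body p.

(** * Closedness of the formulas and bounds on their size *)

Lemma body_closed_sub (A : finType) (b b' : seq nat) (p : body A nat) :
  {subset b <= b'} -> body_closed b p -> body_closed b' p.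
Proof.
move=> bb'; elim: p => //= [p IHp q IHq|p IHp q IHq].
  by move=> /andP [/IHp -> /IHq].
by move=> /andP [/IHp -> /IHq].
Qed.

Lemma prenex_closed (A : finType) n (p : body A nat) (b : seq nat) :
  body_closed (iota 0 n ++ b) p -> closed_under b (prenex n p).
Proof.
elim: n b => //= n IHn b Hp; apply: IHn; apply: body_closed_sub Hp => x.
by rewrite !(inE, mem_cat, mem_iota); lia.
Qed.

Lemma All_closed K b (T : eqType) (s : seq T) (F : T -> form K) :
  0 \in b -> (forall a, a \in s -> body_closed b (F a)) -> body_closed b (All s F).
Proof.
move=> b0; elim: s => [|a s IHs] HF /=; first by rewrite b0.
by rewrite HF ?mem_head // IHs // => a' Ha'; rewrite HF // inE Ha' orbT.
Qed.

Definition term_bound (t : term) : nat :=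
  match t with Var k | Suc k => k.+1 | Zero => 0 end.

Definition literal_bound S (a : literal S) : nat :=
  arity a + \max_(j < arity a) term_bound (arg a j).

Definition clause_bound S (c : clause S) : nat :=
  (n_prem c).+3 + literal_bound (concl c) + \max_(i < n_prem c) literal_bound (prem c i).

(** One number bounds all that must fit: the outputs for the symbols, the inputs for slots and
    clause variables, and the trace variables. *)
Definition program_bound n (f : recf n) : nat :=
  #|symbol f| + \max_(sb : symbol f * bool) clause_bound (program id sb.1 sb.2).

Lemma full_closed K b x : 0 \in b -> x \in b -> body_closed b (full x : form K).
Proof. by move=> b0 bx; apply: All_closed. Qed.

Lemma literal_form_closed K b S (a : literal S) x :
  0 \in b -> 1 \in b -> x \in b -> body_closed b (literal_form a x : form K).
Proof.
by move=> b0 b1 bx; apply: All_closed => // j _; case: arg => [k|k|] /=; rewrite ?b1 ?bx.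
Qed.

Lemma clause_form_closed K n (S : finType) (c : clause S) :
  clause_bound c <= n -> body_closed (iota 0 n) (clause_form c : form K).
Proof.
rewrite /clause_bound => Hn.
have inb x : x < (n_prem c).+3 -> x \in iota 0 n by rewrite mem_iota; lia.
rewrite /= !full_closed ?literal_form_closed ?inb //= !andbT.
apply: All_closed => [|i]; rewrite ?inb // mem_iota => Hi /=.
by rewrite literal_form_closed ?full_closed ?inb.
Qed.

Lemma core_closed K (f : recf 2) n :
  2 < n -> program_bound f <= n -> body_closed (iota 0 n) (core f : form K).
Proof.
move=> n2 Hn; have inb x : x < 3 -> x \in iota 0 n by rewrite mem_iota; lia.
rewrite /= full_closed ?inb //= !andbT; apply: All_closed => [|sb _]; first exact: inb.
apply: clause_form_closed; apply: leq_trans Hn; apply: leq_trans (leq_addl _ _).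
exact: (leq_bigmax sb).
Qed.

Lemma input_closed K b j a : 0 \in b -> body_closed b (input j a : form K).
Proof. by move=> b0; elim: a => //= a ->; rewrite b0. Qed.

(** * Semantics *)

Lemma sat_And (A : finType) V (Pi : assignment A V) i p q :
  body_sat Pi i (And p q) <-> body_sat Pi i p /\ body_sat Pi i q.
Proof. by []. Qed.

Lemma sat_Imp (A : finType) V (Pi : assignment A V) i p q :
  body_sat Pi i (Imp p q) <-> (body_sat Pi i p -> body_sat Pi i q).
Proof.
split=> [H Hp|H [Hp]]; last by apply; apply: H.
by apply: contrapT => Hq; apply: H.
Qed.

Lemma sat_Ev (A : finType) V (Pi : assignment A V) p :
  body_sat Pi 0 (Ev p) <-> exists i, body_sat Pi i p.
Proof.
split=> [[i [_ Hi _]]|[i Hi]]; exists i => //; split=> // k _.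
by apply/sat_Imp.
Qed.

Lemma sat_All K (T : eqType) Pi i (s : seq T) (F : T -> form K) :
  body_sat Pi i (All s F) <-> forall a, a \in s -> body_sat Pi i (F a).
Proof.
elim: s => [|a s IHs].
  by split=> // _; apply/sat_Imp.
split=> [[Ha /IHs Hs] a'|H].
  by rewrite inE => /orP [/eqP ->|/Hs].
split; first by apply: H; rewrite mem_head.
by apply/IHs => a' Ha'; apply: H; rewrite inE Ha' orbT.
Qed.

Section Runs.

Context {K : nat} (sigma : strategy 'I_K.+1 'I_K.+1).
Implicit Types (w : nat -> {set 'I_K.+1}) (ws : nat -> nat -> {set 'I_K.+1}).

Definition run ws : assignment ('I_K.+1 + 'I_K.+1)%type nat :=
  fun x => Some (outcome sigma (ws x)).

Lemma in_outcome_inl w i a : (inl a \in outcome sigma w i) = (a \in w i).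
Proof.
rewrite inE mem_imset; last by move=> ? ? [].
by apply/orP/idP => [[//|/imsetP [] //]|]; left.
Qed.

Lemma in_outcome_inr w i b :
  (inr b \in outcome sigma w i) = (b \in sigma (prefix_upto w i)).
Proof.
rewrite inE orbC mem_imset; last by move=> ? ? [].
by apply/orP/idP => [[//|/imsetP [] //]|]; left.
Qed.

(** Every trace is the outcome of a word, so a block of universal quantifiers becomes one choice of
    words; closedness allows the variables from [n] on to be assigned as well. *)
Lemma models_prenex n (p : form K) : body_closed (iota 0 n) p ->
  models (traces sigma) (prenex n p) <-> forall ws, body_sat (run ws) 0 p.
Proof.
move=> cp; rewrite /models.
have closed_sat ws i : body_sat (run ws) i p <-> body_sat
    (fun x => if x < n then Some (outcome sigma (ws x)) else None) i p.
  elim: p cp i => /= [a x|p IHp|p IHp q IHq|p IHp|p IHp q IHq].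
  - by rewrite mem_iota add0n /= => -> i.
  - by move=> /IHp H i; split=> Hn /H.
  - by move=> /andP [/IHp Hp /IHq Hq] i; split=> -[/Hp ? /Hq ?].
  - by move=> /IHp H i; apply: H.
  - move=> /andP [/IHp Hp /IHq Hq] i.
    by split=> -[j [ij /Hq Hj H]]; exists j; split=> // k /H /Hp.
(* The induction on [n] needs an arbitrary assignment of the variables already quantified. *)
suff H Pi : hyperltl_sat (traces sigma) Pi 0 (prenex n p) <-> forall ws, body_sat
    (fun x => if x < n then Some (outcome sigma (ws x)) else Pi x) 0 p.
  by rewrite H; split=> Hp ws; apply/closed_sat.
elim: n Pi {cp closed_sat} => [|n IHn] Pi /=.
  by split=> // /(_ (fun _ _ => set0)).
split=> [H ws|H t [w ->]].
  have /IHn /(_ ws) := H _ (ex_intro _ (ws n) erefl).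
  congr body_sat; apply: funext => x; rewrite /assign ltnS.
  by case: ltngtP => // ->.
apply/IHn => ws; have := H (fun x => if x == n then w else ws x).
congr body_sat; apply: funext => x; rewrite /assign ltnS.
by case: ltngtP.
Qed.

Definition first w (j a : nat) : Prop :=
  inord j \in w a /\ forall b, b < a -> inord j \notin w b.

Lemma first_unique w j a b : first w j a -> first w j b -> a = b.
Proof.
move=> [Ha Na] [Hb Nb]; case: (ltngtP a b) => // [/Nb|/Na].
  by rewrite Ha.
by rewrite Hb.
Qed.

Lemma sat_mark ws i j x : body_sat (run ws) i (mark j x) = (inord j \in ws x i).
Proof. by rewrite /= in_outcome_inl. Qed.

Lemma sat_full ws i x : body_sat (run ws) i (full x) <-> ws x i = setT.
Proof.
rewrite sat_All; split=> [H|H o _]; last by rewrite /= in_outcome_inl H inE.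
by apply/setP => o; have := H o (mem_enum _ _); rewrite /= in_outcome_inl inE.
Qed.

Lemma sat_hold ws (S : finType) (s : S) x :
  body_sat (run ws) 0 (hold s x) <-> exists i, ws x i = setT /\
    inord (enum_rank s) \in sigma (prefix_upto (ws x) i).
Proof.
rewrite sat_Ev; split=> -[i [Hi Hs]]; exists i; split.
- exact/sat_full.
- by move: Hs; rewrite /= in_outcome_inr.
- exact/sat_full.
- by rewrite /= in_outcome_inr.
Qed.

Lemma sat_input ws j a : body_sat (run ws) 0 (input j a) <-> first (ws 0) j a.
Proof.
suff H i : body_sat (run ws) i (input j a) <->
    inord j \in ws 0 (i + a) /\ forall b, b < a -> inord j \notin ws 0 (i + b).
  exact: H.
elim: a i => [|a IHa] i.
  by rewrite sat_mark addn0; split=> [|[]].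
rewrite /= in_outcome_inl; split=> [[/negP N0 /IHa [Ha Na]]|[Ha Na]].
  split; first by rewrite addnS.
  by case=> [|b]; rewrite ?addn0 // addnS ltnS -addSn; apply: Na.
split; first by apply/negP; have := Na 0 isT; rewrite addn0.
apply/IHa; split; first by rewrite addSnnS.
by move=> b Hb; rewrite addSnnS; apply: Na.
Qed.

(** The position where an until formula stops is forced to be the first position of both marks, up
    to the shift by one for [Suc]. *)
Lemma sat_slot_is ws v j x a t :
  first (ws x) j a -> (forall k, k < term_bound t -> first (ws 1) k (v k)) ->
  body_sat (run ws) 0 (slot_is j x t) <-> a = term_eval v t.
Proof.
move=> Ha; case: t => [k /(_ _ (leqnn _)) Hk|k /(_ _ (leqnn _)) Hk|_]; first last.
- rewrite sat_mark; split=> [H0|E]; last by move: Ha; rewrite E => -[].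
  by apply: first_unique Ha _.
- split=> [[i [_ [[Hi Ni] HSi] Hl]]|E].
    have fk : first (ws 1) k i.
      split; first by move: Hi; rewrite /= in_outcome_inl.
      by move=> b Hb; have [_] := Hl b Hb; rewrite /= in_outcome_inl => /negP.
    rewrite /= (first_unique Hk fk); apply: first_unique Ha _.
    split; first by move: HSi; rewrite /= in_outcome_inl.
    move=> b; rewrite ltnS leq_eqVlt => /orP [/eqP ->|Hb].
      by move: Ni; rewrite /= in_outcome_inl => /negP.
    by have [] := Hl b Hb; rewrite /= in_outcome_inl => /negP.
  exists (v k); rewrite /= !in_outcome_inl; rewrite E in Ha.
  case: Ha Hk => Ha Na [Hk Nk]; split=> // [|b Hb].
    by do 2?split=> //; apply/negP/Na.
  by rewrite /= !in_outcome_inl; split; apply/negP; [apply: Na => /=; lia|apply: Nk].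
- split=> [[i [_ [Hi Hki] Hl]]|E].
    have -> : a = i.
      apply: first_unique Ha _; split; first by move: Hi; rewrite /= in_outcome_inl.
      by move=> b Hb; have [] := Hl b Hb; rewrite /= in_outcome_inl => /negP.
    apply: first_unique _ Hk; split; first by move: Hki; rewrite /= in_outcome_inl.
    by move=> b Hb; have [_] := Hl b Hb; rewrite /= in_outcome_inl => /negP.
  rewrite /= in E; exists a; case: Ha Hk => Ha Na; rewrite -E => -[Hk Nk].
  split=> // [|b Hb]; first by rewrite /= !in_outcome_inl.
  by rewrite /= !in_outcome_inl; split; apply/negP; [apply: Na|apply: Nk].
Qed.

Lemma sat_literal ws v e S (a : literal S) x :
  (forall j, j < literal_bound a -> first (ws x) j (e j)) ->
  (forall k, k < literal_bound a -> first (ws 1) k (v k)) ->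
  body_sat (run ws) 0 (literal_form a x) <-> matches v e a.
Proof.
move=> He Hv; rewrite sat_All.
have Hj j : j < arity a ->
    body_sat (run ws) 0 (slot_is j x (arg a j)) <-> e j = term_eval v (arg a j).
  move=> Hj; apply: sat_slot_is; first by apply: He; rewrite ltn_addr.
  move=> k Hk; apply: Hv; apply: leq_trans Hk _; apply: leq_trans (leq_addl _ _).
  exact: (leq_bigmax (Ordinal Hj)).
by split=> H j; [move=> aj; apply/Hj/H|rewrite mem_iota => aj; apply/Hj/H];
  rewrite ?mem_iota.
Qed.

(** Inputs stay on from their entry onwards, which makes the word eventually full. *)
Definition word_of (e : nat -> nat) : nat -> {set 'I_K.+1} :=
  fun i => [set o : 'I_K.+1 | e o <= i].

Lemma first_word_of e j : j < K.+1 -> first (word_of e) j (e j).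
Proof.
by move=> Hj; split=> [|b]; rewrite inE inordK // -ltnNge.
Qed.

Lemma word_of_full e : exists i, word_of e i = setT.
Proof.
exists (\max_(o < K.+1) e o); apply/setP => o; rewrite !inE.
exact: (leq_bigmax o).
Qed.

(* An output must be on for every continuation of the tuple to a full word, so
   that entries beyond the arity of a literal do not matter. *)
Definition induced (S : finType) : interpretation S := fun s e =>
  forall w, (forall j, j < K.+1 -> first w j (e j)) -> (exists i, w i = setT) ->
    exists i, w i = setT /\ inord (enum_rank s) \in sigma (prefix_upto w i).

(** Trace 0 is pinned to [w0] because [matrix] grants the clauses only under its hypotheses on trace
    0. Since [induced] quantifies over all full words, the conclusion trace must be arbitrary, while
    one word suffices for each premise. *)
Lemma induced_clause (S : finType) (c : clause S) w0 :
  clause_bound c <= K.+1 ->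
  (forall ws, ws 0 = w0 -> body_sat (run ws) 0 (clause_form c)) ->
  clause_holds (@induced S) c.
Proof.
move=> bc Hc v e He Hp w Hw Fw.
have {Hp} /choice [e' He'] i : exists e', i < n_prem c ->
    matches v e' (prem c i) /\ induced (psym (prem c i)) e'.
  by have [/Hp [e' ?]|_] := ltnP i (n_prem c); [exists e'|exists e].
pose ws x := match x with
  | 0 => w0 | 1 => word_of v | 2 => w | i.+3 => word_of (e' i) end.
have /sat_Imp := Hc ws erefl; rewrite sat_hold; apply; split; first split.
- by apply/sat_Ev; have [i Hi] := word_of_full v; exists i; apply/sat_full.
- by apply/sat_Ev; case: Fw => i Hi; exists i; apply/sat_full.
split.
  apply: (proj2 (sat_literal _ _)) He => j Hj; [apply: Hw|apply: first_word_of];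
    by move: bc; rewrite /clause_bound; lia.
apply/sat_All => i; rewrite mem_iota => Hi; have [Mi Ii] := He' i Hi.
have bi : literal_bound (prem c i) <= K.+1.
  apply: leq_trans bc; apply: leq_trans (leq_addl _ _).
  exact: (leq_bigmax (Ordinal Hi)).
split.
  by apply: (proj2 (sat_literal _ _)) Mi => j Hj; apply: first_word_of;
    apply: leq_trans bi.
by apply/sat_hold; apply: Ii; [move=> j; apply: first_word_of|apply: word_of_full].
Qed.

End Runs.

(** * Unrealizability when the computation returns 0 *)

Lemma matrix_closed K m (f : recf 2) : 1 < K -> program_bound f <= K.+1 ->
  body_closed (iota 0 K.+1) (matrix m (core f) : form K).
Proof.
move=> K1 bf; have cq : body_closed (iota 0 K.+1) (core f : form K) by exact: core_closed.
by apply/andP; split=> //; apply/andP; split; apply: input_closed.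
Qed.

(** The interpretation induced by a realizing strategy would be a model of the program, hence
    contain the graph of [f], and so the tuple that [core] forbids on trace 0. *)
Lemma core_unrealizable K m (f : recf 2) sigma :
  1 < K -> program_bound f <= K.+1 -> eval f [tuple K.+1; m] 0 ->
  ~ models (traces sigma) (prenex K.+1 (matrix m (core f) : form K)).
Proof.
move=> K1 bf Hf; rewrite models_prenex; last exact: matrix_closed.
(* The default 0 of [nth] is the value of [f] in slot 2; it also makes [mark 2 0] true at time 0. *)
move=> H; pose e := nth 0 [:: K.+1; m].
have {}H ws : ws 0 = word_of e -> body_sat (run sigma ws) 0 (core f).
  move=> ws0; have /sat_Imp := H ws; apply.
  by split; apply/sat_input; rewrite ws0; apply: (first_word_of e); lia.
have He : graph f e by apply: eval_congr Hf _ _.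
have : induced sigma (None : symbol f) e.
  apply: (program_sound (emb := id)) He => s b.
  apply: (@induced_clause _ _ _ _ (word_of e)).
    apply: leq_trans bf; apply: leq_trans (leq_addl _ _).
    exact: (leq_bigmax (s, b)).
  by move=> ws /H [/sat_All /(_ (s, b)) + _]; rewrite mem_enum; apply.
move=> /(_ (word_of e)) Ie; have [_ [N _]] := H (fun=> word_of e) erefl.
apply: N; split; first by rewrite /= in_outcome_inl inE inordK.
by apply/sat_hold; apply: Ie; [move=> j; apply: first_word_of|apply: word_of_full].
Qed.

(** * The standard strategy *)

Definition entries K (u : seq {set 'I_K.+1}) (j : nat) : nat :=
  find (fun a : {set 'I_K.+1} => inord j \in a) u.

(** The spare flag depends only on the first input letter, hence is constant along each word; the
    choice of [g] decides whether it agrees across words. *)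
Definition standard_strategy K (f : recf 2) (g : {set 'I_K.+1} -> bool) :
    strategy 'I_K.+1 'I_K.+1 := fun u =>
  [set o : 'I_K.+1 |
    [exists s : symbol f,
       (o == enum_rank s :> nat) && `[< standard s (entries (sval u)) >]]
    || ((o == #|symbol f| :> nat) && g (head set0 (sval u)))].

Lemma in_standard_strategy K (f : recf 2) g u (s : symbol f) : program_bound f <= K.+1 ->
  inord (enum_rank s) \in @standard_strategy K f g u <-> standard s (entries (sval u)).
Proof.
move=> bf; have ltS : enum_rank s < #|symbol f| by [].
have ltK : enum_rank s < K.+1.
  by apply: leq_trans ltS _; apply: leq_trans bf; apply: leq_addr.
rewrite inE inordK // (ltn_eqF ltS) orbF; split=> [/existsP [s']|Hs].
  by move=> /andP [/eqP/val_inj/enum_rank_inj <- /asboolP].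
by apply/existsP; exists s; rewrite eqxx; apply/asboolP.
Qed.

Lemma in_standard_strategy_flag K (f : recf 2) g u : program_bound f <= K ->
  (inord #|symbol f| \in @standard_strategy K f g u) = g (head set0 (sval u)).
Proof.
move=> bf; have ltK : #|symbol f| < K.+1.
  by rewrite ltnS; apply: leq_trans bf; apply: leq_addr.
rewrite inE inordK // eqxx /= orb_idl // => /existsP [s /andP [/eqP E _]].
by have := ltn_ord (enum_rank s); rewrite -E ltnn.
Qed.

Lemma first_entries K (w : nat -> {set 'I_K.+1}) i j : w i = setT ->
  first w j (entries (mkseq w i.+1) j).
Proof.
move=> wi; set p := fun a : {set 'I_K.+1} => inord j \in a.
have hp : has p (mkseq w i.+1).
  by apply/hasP; exists (w i); [apply: map_f; rewrite mem_iota /=|rewrite /p wi inE].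
have lt : find p (mkseq w i.+1) < i.+1 by rewrite -[X in _ < X](size_mkseq w) -has_find.
split; first by have := nth_find set0 hp; rewrite nth_mkseq.
move=> b Hb; have := before_find set0 Hb; rewrite nth_mkseq ?(ltn_trans Hb) //.
by rewrite /p => ->.
Qed.

(** At every full position the outputs report the truth of [standard] on the tuple read so far,
    which is the tuple of the whole trace; the clauses then hold by [standard_program]. *)
Lemma standard_strategy_program K (f : recf 2) g ws : program_bound f <= K.+1 ->
  body_sat (run (standard_strategy f g) ws) 0 (program_form f : form K).
Proof.
move=> bf; apply/sat_All => -[s b] _.
rewrite [X in body_sat _ _ X]/(clause_form (program id s b)).
have := @standard_program _ f _ id _ (fun=> erefl) s b.
move: (program _ _ _) => c Hc.
apply/sat_Imp => -[[/sat_Ev [i1 /sat_full F1] /sat_Ev [i2 /sat_full F2]] [Hh Hp]].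
apply/sat_hold; exists i2; split=> //; apply/in_standard_strategy => //=.
have Hv k := first_entries k F1.
apply: (Hc (entries (mkseq (ws 1) i1.+1))).
  by apply: (proj1 (@sat_literal _ _ ws _ _ _ (concl c) 2 _ _)) Hh => j _;
    apply: first_entries.
move=> i Hi; move: Hp => /sat_All /(_ i).
rewrite mem_iota => /(_ Hi) [Hl /sat_hold [k [Fk /in_standard_strategy Hk]]].
exists (entries (mkseq (ws i.+3) k.+1)); split; last exact: Hk.
by apply: (proj1 (@sat_literal _ _ ws _ _ _ (prem c i) i.+3 _ _)) Hl => j _;
  apply: first_entries.
Qed.

Lemma standard_strategy_models K m (f : recf 2) b :
  1 < K -> program_bound f <= K -> ~ eval f [tuple K.+1; m] 0 ->
  models (traces (standard_strategy f (fun=> b)))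
    (prenex K.+1 (matrix m (core f) : form K)).
Proof.
move=> K1 bf Nf; apply/models_prenex; first by apply: matrix_closed => //; apply: leqW.
move=> ws; apply/sat_Imp => /sat_And [/sat_input H0 /sat_input H1].
split; first exact/standard_strategy_program/leqW.
split; last first.
  apply/sat_Imp; rewrite /= !in_outcome_inr.
  by rewrite !in_standard_strategy_flag.
move=> [H2 /sat_hold [i [Fi]]].
rewrite in_standard_strategy; last exact: leqW.
(* Slots 0 and 1 are the arguments imposed on trace 0; slot 2 is 0 because its mark is on at time
   0. *)
rewrite standard_None => Hf; apply: Nf; apply: eval_congr Hf _ _ => /=.
  exact: (congr2 (fun a b => [:: a; b]) (first_unique (first_entries 0 Fi) H0)
            (first_unique (first_entries 1 Fi) H1)).
apply: first_unique (first_entries 2 Fi) _; split=> //.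
by move: H2; rewrite /= in_outcome_inl.
Qed.

Lemma standard_strategy_not_models K m (f : recf 2) :
  1 < K -> program_bound f <= K ->
  ~ models (traces (standard_strategy f (fun a => ord0 \in a)))
      (prenex K.+1 (matrix m (core f) : form K)).
Proof.
move=> K1 bf /models_prenex H.
(* Trace 0 meets the hypotheses of [matrix]; the first letters of traces 1 and 2 disagree on [ord0],
   hence so do their spare flags. *)
pose ws x : nat -> {set 'I_K.+1} := match x with
  | 0 => word_of (nth 0 [:: K.+1; m]) | 1 => fun=> setT | _ => fun=> set0 end.
have /sat_Imp Hws := H (matrix_closed _ K1 (leqW bf)) ws.
have /Hws /sat_And [_ /sat_And [_ /sat_Imp]] :
    body_sat (run (standard_strategy f (fun a => ord0 \in a)) ws) 0
      (And (input 0 K.+1) (input 1 m)).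
  by split; apply/sat_input; apply: (first_word_of (nth 0 [:: K.+1; m])); lia.
rewrite /= !in_outcome_inr !in_standard_strategy_flag //=.
by rewrite !inE => /(_ isT).
Qed.

(** If 0 is not returned, both constant choices of [g] satisfy the sentence, and the mixed strategy,
    which violates it, has only traces of these two; an LTL formula sees single traces and cannot
    tell. *)
Lemma expressible_iff_eval K m (f : recf 2) :
  1 < K -> program_bound f <= K ->
  (exists psi : ltl ('I_K.+1 + 'I_K.+1)%type, forall sigma : strategy 'I_K.+1 'I_K.+1,
     models (traces sigma) (prenex K.+1 (matrix m (core f) : form K)) <->
     (forall t, traces sigma t -> ltl_sat t psi)) <->
  eval f [tuple K.+1; m] 0.
Proof.
move=> K1 bf; split=> [[psi Hpsi]|Hf]; last first.
  (* An unsatisfiable formula works, since every strategy has at least one trace. *)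
  exists (Not (Imp (Atom (inl ord0) tt) (Atom (inl ord0) tt))) => sigma.
  split=> [/core_unrealizable H|H]; first by case: H => //; apply: leqW.
  by exfalso; apply: (H _ (ex_intro _ (fun=> set0) erefl)) => /= -[].
apply: contrapT => Nf; case: (@standard_strategy_not_models K m f K1 bf).
apply/Hpsi => t [w ->].
(* On [w], the constant strategy with bit [ord0 \in w 0] has the same outcome as the mixed one. *)
have /Hpsi := @standard_strategy_models K m f (ord0 \in w 0) K1 bf Nf.
by apply; exists w; apply: funext.
Qed.

(** * The diagonal instance *)

Definition not_mark_code (j : nat) : nat :=
  pair_code 1 (pair_code 0 (pair_code (pair_code 0 j) 0)).

Definition input_code (j a : nat) : nat :=
  nat_rect (fun=> nat) (pair_code 0 (pair_code (pair_code 0 j) 0))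
    (fun _ z => pair_code 2 (pair_code (not_mark_code j) (pair_code 3 z))) a.

(** Here [m] occurs twice: as the number imposed by [input_code 1 m] and as the code of the inner
    formula. *)
Definition diagonal_code (k m : nat) : nat :=
  pair_code k (pair_code k
    (nat_rect (fun=> nat)
       (pair_code 2 (pair_code 1 (pair_code 2 (pair_code
          (pair_code 2 (pair_code (input_code 0 k) (input_code 1 m))) (pair_code 1 m)))))
       (fun i z => pair_code 0 (pair_code i z)) k)).

Lemma input_codeE K j a : j < K.+1 -> body_code (input j a : form K) = input_code j a.
Proof. by move=> jK; elim: a => [|a IHa] /=; rewrite ?IHa /= ?inordK. Qed.

Lemma matrix_code K m (q : form K) : 1 < K ->
  body_code (matrix m q) = pair_code 1 (pair_code 2 (pair_code
    (pair_code 2 (pair_code (input_code 0 K.+1) (input_code 1 m)))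
    (pair_code 1 (body_code q)))).
Proof.
move=> K1; have := @input_codeE K 0 K.+1 isT; have := @input_codeE K 1 m (ltnW K1).
by rewrite /matrix; move: (input 0 _) (input 1 _) => p0 p1 <- <-.
Qed.

Lemma prenex_code a b n (p : body ('I_a + 'I_b)%type nat) :
  hyperltl_code (prenex n p) = nat_rect (fun=> nat) (pair_code 2 (body_code p))
    (fun i z => pair_code 0 (pair_code i z)) n.
Proof. by elim: n => //= n ->. Qed.

Lemma diagonal_codeE K (q : form K) (m := body_code q)
    (c : Defs.closed (prenex K.+1 (matrix m q))) :
  1 < K -> instance_code (Instance c) = diagonal_code K.+1 m.
Proof.
move=> K1; rewrite /instance_code /diagonal_code; congr (pair_code _ (pair_code _ _)).
by apply: etrans (prenex_code _ _) _; rewrite matrix_code.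
Qed.

Lemma computable_input_code n j (F : n.-tuple nat -> nat) :
  computable F -> computable (fun x => input_code j (F x)).
Proof.
move=> cF.
apply: (@computable_rec n F _ (fun _ z _ =>
  pair_code 2 (pair_code (not_mark_code j) (pair_code 3 z)))) => //.
  exact: computable_const.
do !apply: computable_pair; try exact: computable_const.
exact: computable_second.
Qed.

Lemma computable_diagonal_code :
  computable (fun x : 2.-tuple nat => diagonal_code (tnth x ord0) (tnth x ord_max)).
Proof.
do 2![apply: computable_pair; first exact: computable_proj].
apply: (@computable_rec 2 _ _ (fun i z _ => pair_code 0 (pair_code i z))).
- exact: computable_proj.
- do ?[apply: computable_pair]; try exact: computable_const;
    try exact: computable_proj; apply: computable_input_code; exact: computable_proj.
- do !apply: computable_pair; first exact: computable_const.
    exact: (computable_proj ord0).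
  exact: computable_second.
Qed.

Theorem theorem5 :
  undecidable instance_code
    (fun I : instance =>
       exists psi : ltl ('I_(n_in I) + 'I_(n_out I))%type,
         forall sigma : strategy 'I_(n_in I) 'I_(n_out I),
           models (traces sigma) (spec I) <->
           (forall t, traces sigma t -> ltl_sat t psi)).
Proof.
move=> [d Hd]; have [r Hr] := computable_diagonal_code.
(* The alphabet size is an argument of [f], so [f] is fixed before [K] is chosen above its bound;
   likewise [q] is fixed before [m]. *)
pose f := RComp d (fun _ : 'I_1 => r).
pose K := (program_bound f).+2; pose q : form K := core f; pose m := body_code q.
have K1 : 1 < K by [].
have bf : program_bound f <= K by rewrite /K; lia.
have c : Defs.closed (prenex K.+1 (matrix m q)).
  by apply: prenex_closed; rewrite cats0; apply: matrix_closed => //; apply: leqW.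
have fE y : eval f [tuple K.+1; m] y <-> eval d [tuple diagonal_code K.+1 m] y.
  have Hz := Hr [tuple K.+1; m]; split=> [[z [/(_ ord0) Hz' Hy]]|Hy].
    have <- // : z = [tuple diagonal_code K.+1 m].
    by apply: eq_from_tnth => i; rewrite ord1 (eval_functional Hz' Hz).
  by exists [tuple diagonal_code K.+1 m]; split=> // i; rewrite ord1.
have [yes no] := Hd (Instance c).
rewrite (diagonal_codeE c K1) /= in yes no.
have := expressible_iff_eval m K1 bf; rewrite fE; set P := ex _ => PE.
(* If [P] fails, the answer 0 of [d] makes it true; if [P] holds, [d] returns both 0 and 1. *)
have [p|/no /PE //] := pselect P.
by have /PE e0 := p; have := eval_functional e0 (yes p).
Qed.
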